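(* Let $M$ be a smooth $n$-dimensional manifold, $\nabla$ an affine connection on $M$, and $h$ a non-degenerate symmetric $(0,2)$-tensor field on $M$ with $\nabla h=0$. Let $\hat\nabla$ and $\hat\nabla^*$ be the connections on $TM\oplus T^*M$ given by $$\hat\nabla_{X+\eta}(Y+\beta)=\nabla_XY+h(\nabla_X(h^{-1}(\beta))),\qquad \hat\nabla^*_{X+\eta}(Y+\beta)=h^{-1}(\nabla_X(h(Y)))+\nabla_X\beta,$$ and for $\alpha\in\mathbb{R}$ let $\hat\nabla^{(\alpha)}=\frac{1+\alpha}{2}\hat\nabla+\frac{1-\alpha}{2}\hat\nabla^*$. Then for every $\alpha\in\mathbb{R}$ $$\operatorname{Ric}^{\hat\nabla^{(\alpha)}}(Y+\beta,Z+\gamma)=\operatorname{Ric}^{\nabla}(Y,Z)$$ for all vector fields $Y,Z$ and $1$-forms $\beta,\gamma$ on $M$, and $$\operatorname{scal}^{(\check h,\hat\nabla^{(\alpha)})}=\operatorname{scal}^{(h,\nabla)}.$$ Hence the Ricci curvature tensor field of $\hat\nabla^{(\alpha)}$ is symmetric if and only if the Ricci curvature tensor field of $\nabla$ is symmetric.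
   Context: The tensor $h$ is identified with the bundle isomorphism $h:TM\to T^*M$, $h(X)=h(X,\cdot)$, with inverse $h^{-1}$. The connection $\nabla$ acts on $1$-forms by $(\nabla_X\beta)(Y)=X(\beta(Y))-\beta(\nabla_XY)$, and $R^\nabla(X,Y)=\nabla_X\nabla_Y-\nabla_Y\nabla_X-\nabla_{[X,Y]}$. On $TM\oplus T^*M$: the bracket is $[X+\eta,Y+\beta]_\nabla=[X,Y]+\nabla_X\beta-\nabla_Y\eta$; the bilinear form is $\check h(X+\eta,Y+\beta)=h(X,Y)+h(h^{-1}(\eta),h^{-1}(\beta))$; the curvature of a connection $D$ is $R^D(\sigma,\tau)\nu=D_\sigma D_\tau\nu-D_\tau D_\sigma\nu-D_{[\sigma,\tau]_\nabla}\nu$. Let $\{E_i\}$ be a local $h$-orthonormal frame, $\varepsilon_i=h(E_i,E_i)\in\{1,-1\}$, and let $e_i^{\pm}=\frac1{\sqrt2}(E_i\pm h(E_i))$, a $\check h$-orthonormal frame of $TM\oplus T^*M$. Then $\operatorname{Ric}^\nabla(Y,Z)=\sum_i\varepsilon_i h(R^\nabla(E_i,Y)Z,E_i)$, $\operatorname{scal}^{(h,\nabla)}=\sum_i\varepsilon_i\operatorname{Ric}^\nabla(E_i,E_i)$, and for a connection $D$ on $TM\oplus T^*M$, $\operatorname{Ric}^D(\sigma,\nu)=\sum_i\varepsilon_i\{\check h(R^D(e_i^+,\sigma)\nu,e_i^+)+\check h(R^D(e_i^-,\sigma)\nu,e_i^-)\}$, $\operatorname{scal}^{(\check h,D)}=\sum_i\varepsilon_i\{\operatorname{Ric}^D(e_i^+,e_i^+)+\operatorname{Ric}^D(e_i^-,e_i^-)\}$.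 *)

(* Defs.v *)
From HB Require Import structures.
From mathcomp Require Import all_boot all_order all_algebra.
From mathcomp Require Import ring.
From mathcomp Require Import all_classical all_reals all_analysis.

Set Implicit Arguments.
Unset Strict Implicit.
Unset Printing Implicit Defensive.

Import Order.TTheory GRing.Theory Num.Theory numFieldNormedType.Exports.

Local Open Scope classical_set_scope.
Local Open Scope ring_scope.

Section SmoothOn.
Context {R : realType} {n : nat}.
Implicit Types (O : set 'rV[R]_n) (f g : 'rV[R]_n -> R).

(* Meant for open O: the conditions then only depend on the values of f on O. *)
Fixpoint Ck_on (k : nat) O f : Prop :=
  (forall x, O x -> {for x, continuous f}) /\
  if k is k'.+1 then
    forall i : 'I_n, (forall x, O x -> derivable f x (delta_mx 0 i)) /\
                     Ck_on k' O (fun x => 'D_(delta_mx 0 i) f x)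
  else True.

Definition smooth_on O f := forall k, Ck_on k O f.

Lemma Ck_on_cont k O f x : Ck_on k O f -> O x -> {for x, continuous f}.
Proof. by case: k => [|k] [+ _]; apply. Qed.

Lemma Ck_onW k O f : Ck_on k.+1 O f -> Ck_on k O f.
Proof.
elim: k f => [|k IH] f; first by case.
move=> [cf Df]; split=> // i; have [df Cf] := Df i; split=> //.
exact: IH.
Qed.

Lemma near_open_eq O f g x : open O -> O x -> (forall y, O y -> f y = g y) ->
  \forall y \near x, f y = g y.
Proof.
by move=> Oo Ox fg; near do apply: fg; exact: open_nbhs_nbhs.
Unshelve. all: by end_near. Qed.

Lemma Ck_on_eq k O f g : open O -> (forall x, O x -> f x = g x) ->
  Ck_on k O f -> Ck_on k O g.
Proof.
move=> Oo; elim: k f g => [|k IH] f g fg [cf Df].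
all: have fgx x (Ox : O x) := near_open_eq Oo Ox fg.
all: have cg x : O x -> {for x, continuous g}.
1,3: move=> Ox; rewrite /prop_for /continuous_at -fg //.
1,2: by apply: cvg_trans (cf _ Ox); exact: near_eq_cvg (fgx x Ox).
  by [].
split=> // i; have [df Cf] := Df i; split=> [x Ox|].
  by apply: near_eq_derivable (fgx x Ox) (df x Ox).
by apply: IH Cf => x Ox; apply: near_eq_derive (fgx x Ox).
Qed.

Lemma Ck_on_cst k O (a : R) : open O -> Ck_on k O (cst a).
Proof.
move=> Oo; elim: k a => [|k IH] a; (split; first by move=> x _; exact: cst_continuous).
  by [].
move=> i; split=> [x _|]; first exact: derivable_cst.
by apply: (Ck_on_eq Oo _ (IH 0)) => x _; rewrite derive_cst.
Qed.

Lemma Ck_onD k O f g : open O -> Ck_on k O f -> Ck_on k O g ->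
  Ck_on k O (f + g).
Proof.
move=> Oo; elim: k f g => [|k IH] f g [cf Df] [cg Dg];
  (split; first by move=> x Ox; apply: continuousD; [exact: cf|exact: cg]).
  by [].
move=> i; have [df Cf] := Df i; have [dg Cg] := Dg i; split=> [x Ox|].
  by apply: derivableD; [exact: df|exact: dg].
apply: (Ck_on_eq Oo _ (IH _ _ Cf Cg)) => x Ox.
by rewrite deriveD; [|exact: df|exact: dg].
Qed.

Lemma Ck_onM k O f g : open O -> Ck_on k O f -> Ck_on k O g ->
  Ck_on k O (f * g).
Proof.
move=> Oo; elim: k f g => [|k IH] f g Cf Cg;
  (split; first by move=> x Ox; apply: continuousM;
    [exact: Ck_on_cont Cf Ox|exact: Ck_on_cont Cg Ox]).
  by [].
move=> i; have [df Dif] := Cf.2 i; have [dg Dig] := Cg.2 i; split=> [x Ox|].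
  by apply: derivableM; [exact: df|exact: dg].
apply: (Ck_on_eq Oo _ (Ck_onD Oo (IH _ _ (Ck_onW Cf) Dig)
                                 (IH _ _ (Ck_onW Cg) Dif))) => x Ox.
by rewrite deriveM; [|exact: df|exact: dg].
Qed.

End SmoothOn.

Record chart (R : realType) (n : nat) (M : topologicalType) := Chart {
  chart_dom : set M;
  chart_map : M -> 'rV[R]_n;
  chart_inv : 'rV[R]_n -> M;
  chart_dom_open : open chart_dom;
  chart_cod_open : open (chart_map @` chart_dom);
  chart_mapK : forall p, chart_dom p -> chart_inv (chart_map p) = p;
  chart_map_cont : forall p, chart_dom p -> {for p, continuous chart_map};
  chart_inv_cont : forall x, (chart_map @` chart_dom) x ->
    {for x, continuous chart_inv}
}.

(* The atlas need not be maximal: two atlases generating the same maximal one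
   have the same smooth functions. *)
Record manifold (R : realType) (n : nat) := Manifold {
  mspace :> topologicalType;
  atlas : set (chart R n mspace);
  manifold_hausdorff : hausdorff_space mspace;
  manifold_second_countable : @second_countable mspace;
  atlas_cover : forall p : mspace, exists2 c, atlas c & chart_dom c p;
  atlas_compatible : forall c d, atlas c -> atlas d -> forall j : 'I_n,
    smooth_on (chart_map c @` (chart_dom c `&` chart_dom d))
              (fun x => chart_map d (chart_inv c x) 0 j)
}.

Section SmoothFunctions.
Context {R : realType} {n : nat} (M : manifold R n).

Definition smooth (f : M -> R) : Prop := forall c, atlas c ->
  smooth_on (chart_map c @` chart_dom c) (f \o chart_inv c).

Definition smoothb : {pred (M -> R)} := fun f => `[< smooth f >].

Lemma smooth_cst (a : R) : smooth (cst a).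
Proof. by move=> c _ k; apply: Ck_on_cst; exact: chart_cod_open. Qed.

Lemma smoothD f g : smooth f -> smooth g -> smooth (f + g).
Proof.
move=> sf sg c cA k; apply: (@Ck_onD R n k _ (f \o chart_inv c));
  [exact: chart_cod_open|exact: sf|exact: sg].
Qed.

Lemma smoothM f g : smooth f -> smooth g -> smooth (f * g).
Proof.
move=> sf sg c cA k; apply: (@Ck_onM R n k _ (f \o chart_inv c));
  [exact: chart_cod_open|exact: sf|exact: sg].
Qed.

Lemma smooth_subring : GRing.subring_closed smoothb.
Proof.
split.
- by apply/asboolP; exact: smooth_cst.
- move=> f g /asboolP sf /asboolP sg; apply/asboolP.
  suff -> : f - g = f + cst (-1) * g.
    by apply: smoothD => //; apply: smoothM => //; exact: smooth_cst.
  by apply/funext => p; rewrite !fctE mulN1r.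
- by move=> f g /asboolP sf /asboolP sg; apply/asboolP; exact: smoothM.
Qed.

HB.instance Definition _ := GRing.isSubringClosed.Build _ smoothb smooth_subring.

Record Cinf := MkCinf { Cinf_fun :> M -> R; _ : smoothb Cinf_fun }.

HB.instance Definition _ := [isSub for Cinf_fun].
HB.instance Definition _ := [Choice of Cinf by <:].
HB.instance Definition _ := GRing.SubChoice_isSubComPzRing.Build _ _ Cinf smooth_subring.

Definition Cinf_cst (a : R) : Cinf := MkCinf (asboolT (smooth_cst a)).

End SmoothFunctions.

Section VectorFields.
Context {R : realType} {n : nat} (M : manifold R n).

Notation C := (Cinf M).

(* Vector fields are the R-linear derivations of the ring of smooth functions;
   the value at p of a vector field X is the tangent vector f |-> X f p. *)
Definition derivation (X : C -> C^o) : Prop :=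
  (forall (a : R) (f g : C), X (Cinf_cst M a * f + g) = Cinf_cst M a * X f + X g)
  /\ (forall f g : C, X (f * g) = X f * g + f * X g).

Definition derivationb : {pred (C -> C^o)} := fun X => `[< derivation X >].

Lemma derivation_submod : GRing.submod_closed derivationb.
Proof.
split.
  apply/asboolP; split=> [a f g|f g].
    by change (0 = Cinf_cst M a * 0 + 0 :> C); rewrite mulr0 addr0.
  by change (0 = 0 * g + f * 0 :> C); rewrite mul0r mulr0 addr0.
move=> u X Y /asboolP[XL XM] /asboolP[YL YM]; apply/asboolP.
split=> [a f g|f g]; rewrite !fctE /GRing.scale/=.
  rewrite XL YL !mulrDr !addrA; congr (_ + _).
  by rewrite mulrCA -!addrA; congr (_ + _); exact: addrC.
rewrite XM YM !mulrDr !mulrDl !mulrA (mulrC f u).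
by rewrite -!addrA; congr (_ + _); rewrite addrCA.
Qed.

HB.instance Definition _ :=
  GRing.isSubmodClosed.Build _ _ derivationb
    (GRing.submod_closed_semi derivation_submod).

Record vfield := MkVField { vfield_fun :> C -> C^o; _ : derivationb vfield_fun }.

HB.instance Definition _ := [isSub for vfield_fun].
HB.instance Definition _ := [Choice of vfield by <:].
HB.instance Definition _ := [SubChoice_isSubLmodule of vfield by <:].

Lemma vfieldP (X : vfield) : derivation X.
Proof. by case: X => X /= /asboolP. Qed.

Lemma vfieldD_arg (X : vfield) f g : X (f + g) = X f + X g.
Proof.
have H1 : Cinf_cst M 1 = 1 by exact: val_inj.
by have := (vfieldP X).1 1 f g; rewrite H1 !mul1r.
Qed.

Lemma lie_subproof (X Y : vfield) :
  derivation (fun f => X (Y f) - Y (X f) : C^o).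
Proof.
split=> [a f g|f g].
  rewrite (vfieldP X).1 (vfieldP Y).1 (vfieldP X).1 (vfieldP Y).1.
  by rewrite mulrBr opprD addrACA.
rewrite (vfieldP X).2 (vfieldP Y).2 !vfieldD_arg.
rewrite !(vfieldP X).2 !(vfieldP Y).2.
move: (X (Y f)) (Y (X f)) (X (Y g)) (Y (X g)) (X f) (Y f) (X g) (Y g).
move=> a b c d x y x' y'; ring.
Qed.

Definition lie (X Y : vfield) : vfield := MkVField (asboolT (lie_subproof X Y)).

(* 1-forms are C-linear functionals on vector fields; (0,2)-tensor fields are
   C-bilinear maps. *)
Definition is_oneform (b : vfield -> C^o) : Prop :=
  forall f X Y, b (f *: X + Y) = f * b X + b Y.

Definition is_oneformb : {pred (vfield -> C^o)} :=
  fun b => `[< is_oneform b >].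

Lemma oneform_submod : GRing.submod_closed is_oneformb.
Proof.
split.
  by apply/asboolP => f X Y; change (0 = f * 0 + 0 :> C); rewrite mulr0 addr0.
move=> u b c /asboolP bL /asboolP cL; apply/asboolP => f X Y.
rewrite !fctE /GRing.scale/= bL cL !mulrDr !addrA; congr (_ + _).
by rewrite mulrCA -!addrA; congr (_ + _); exact: addrC.
Qed.

HB.instance Definition _ := GRing.isSubmodClosed.Build _ _ is_oneformb
    (GRing.submod_closed_semi oneform_submod).

Record oneform :=
  MkOneForm { oneform_fun :> vfield -> C^o; _ : is_oneformb oneform_fun }.

HB.instance Definition _ := [isSub for oneform_fun].
HB.instance Definition _ := [Choice of oneform by <:].
HB.instance Definition _ := [SubChoice_isSubLmodule of oneform by <:].

Lemma oneformP (b : oneform) : is_oneform b.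
Proof. by case: b => b /= /asboolP. Qed.

Record tensor02 := Tensor02 {
  tensor_fun :> vfield -> vfield -> C;
  tensor_linl : forall f X Y Z,
    tensor_fun (f *: X + Y) Z = f * tensor_fun X Z + tensor_fun Y Z;
  tensor_linr : forall f X Y Z,
    tensor_fun X (f *: Y + Z) = f * tensor_fun X Y + tensor_fun X Z
}.

Record affine_connection := AffineConnection {
  nabla_fun :> vfield -> vfield -> vfield;
  nabla_linl : forall f X Y Z,
    nabla_fun (f *: X + Y) Z = f *: nabla_fun X Z + nabla_fun Y Z;
  nablaD : forall X Y Z, nabla_fun X (Y + Z) = nabla_fun X Y + nabla_fun X Z;
  nabla_leibniz : forall (f : C) X Y,
    nabla_fun X (f *: Y) = f *: nabla_fun X Y + (X f : C) *: Y
}.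

Lemma nabla_form_subproof (nabla : affine_connection) (X : vfield)
    (b : oneform) :
  is_oneform (fun Y => X (b Y) - b (nabla X Y) : C^o).
Proof.
move=> f Y Z; rewrite nablaD nabla_leibniz -addrA !oneformP vfieldD_arg (vfieldP X).2.
move: (b (nabla X Y)) (b (nabla X Z)) (b Y) (b Z) (X (b Y)) (X (b Z)) (X f).
move=> *; ring.
Qed.

Definition nabla_form (nabla : affine_connection) (X : vfield)
    (b : oneform) : oneform :=
  MkOneForm (asboolT (nabla_form_subproof nabla X b)).

Section Metric.
Variable h : tensor02.

Definition tensor_symmetric : Prop := forall X Y, h X Y = h Y X.

(* Every tangent vector at p is the value X_p of some vector field X; X_p = 0
   means that X_p kills all smooth functions. *)
Definition tensor_nondegenerate : Prop := forall (p : M) (X : vfield),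
  (forall Y, h X Y p = 0) -> forall f : C, (X f : C) p = 0.

Definition tensor_parallel (nabla : affine_connection) : Prop := forall X Y Z : vfield,
  (X (h Y Z) : C) - h (nabla X Y) Z - h Y (nabla X Z) = 0.

Lemma flat_subproof X : is_oneform (h X : vfield -> C^o).
Proof. by move=> f Y Z; exact: tensor_linr. Qed.

Definition flat X : oneform := MkOneForm (asboolT (flat_subproof X)).

(* h^{-1}; for nondegenerate h, flat is bijective and the default 0 is
   never used *)
Definition sharp (b : oneform) : vfield := xget 0 [set X | flat X = b].

End Metric.

(* sections X + eta of TM (+) T^*M, as pairs (X, eta) *)
Definition gsection : Type := (vfield * oneform)%type.

Section GeneralizedGeometry.
Variables (h : tensor02) (nabla : affine_connection).

Definition gbracket (s t : gsection) : gsection :=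
  (lie s.1 t.1, nabla_form nabla s.1 t.2 - nabla_form nabla t.1 s.2).

Definition check_form (s t : gsection) : C :=
  h s.1 t.1 + h (sharp h s.2) (sharp h t.2).

Definition curvature (X Y Z : vfield) : vfield :=
  nabla X (nabla Y Z) - nabla Y (nabla X Z) - nabla (lie X Y) Z.

Definition gcurvature (D : gsection -> gsection -> gsection)
    (s t u : gsection) : gsection :=
  D s (D t u) - D t (D s u) - D (gbracket s t) u.

(* An orthonormal frame near each point of the open set U. The fields E i are
   defined on all of M but only their restriction to U matters: every local
   orthonormal frame agrees near each point of its domain with such a family.
   Being orthonormal, n = dim M fields automatically form a basis. *)
Definition orthonormal_frame (U : set M) (E : 'I_n -> vfield) : Prop :=
  [/\ open U,
      forall i j p, U p -> i != j -> h (E i) (E j) p = 0 &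
      forall i p, U p -> h (E i) (E i) p = 1 \/ h (E i) (E i) p = -1].

Section Frame.
Variable E : 'I_n -> vfield.

Definition eps (i : 'I_n) : C := h (E i) (E i).

Definition eplus (i : 'I_n) : gsection :=
  Cinf_cst M (Num.sqrt 2)^-1 *: ((E i, flat h (E i)) : gsection).

Definition eminus (i : 'I_n) : gsection :=
  Cinf_cst M (Num.sqrt 2)^-1 *: ((E i, - flat h (E i)) : gsection).

(* When E is an orthonormal frame on U, the values on U of the next four smooth
   functions are the Ricci and scalar curvatures; they do not depend on E. Off U
   they have no meaning. *)
Definition Ric (Y Z : vfield) : C :=
  \sum_(i < n) eps i * h (curvature (E i) Y Z) (E i).

Definition scal : C := \sum_(i < n) eps i * Ric (E i) (E i).

Definition gRic (D : gsection -> gsection -> gsection) (s u : gsection) : C :=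
  \sum_(i < n) eps i *
    (check_form (gcurvature D (eplus i) s u) (eplus i) +
     check_form (gcurvature D (eminus i) s u) (eminus i)).

Definition gscal (D : gsection -> gsection -> gsection) : C :=
  \sum_(i < n) eps i * (gRic D (eplus i) (eplus i) + gRic D (eminus i) (eminus i)).

End Frame.

Definition Ric_symmetric : Prop := forall U E, orthonormal_frame U E ->
  forall Y Z p, U p -> Ric E Y Z p = Ric E Z Y p.

Definition gRic_symmetric (D : gsection -> gsection -> gsection) : Prop :=
  forall U E, orthonormal_frame U E ->
  forall s u p, U p -> gRic E D s u p = gRic E D u s p.

Definition hat_nabla (s t : gsection) : gsection :=
  (nabla s.1 t.1, flat h (nabla s.1 (sharp h t.2))).

Definition hat_nabla_star (s t : gsection) : gsection :=
  (sharp h (nabla_form nabla s.1 (flat h t.1)), nabla_form nabla s.1 t.2).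

Definition alpha_connection (a : R) (s t : gsection) : gsection :=
  Cinf_cst M ((1 + a) / 2) *: hat_nabla s t +
  Cinf_cst M ((1 - a) / 2) *: hat_nabla_star s t.

End GeneralizedGeometry.

End VectorFields.

(* Main.v *)
(** An orthonormal frame spreads each direction [E i] over the pair
[eplus i], [eminus i], whose 1-form parts are opposite.  The alpha-connection
differentiates only along the vector part, so its curvatures in the directions
[eplus i] and [eminus i] coincide, and in the trace the 1-form parts cancel.
On the vector part the alpha-connection is [nabla], because [nabla h = 0] makes
[nabla] commute with [flat]; so only the Ricci curvature of [nabla] remains.
Only the injectivity of [flat] is involved: whatever [sharp] does to the 1-form
part of the curvature cancels. *)

Require Import Defs.
From mathcomp Require Import all_boot all_order all_algebra.
From mathcomp Require Import all_classical all_reals all_analysis.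

Import GRing.Theory Num.Theory.

Local Open Scope classical_set_scope.
Local Open Scope ring_scope.

Section ConstantFunctions.
Context {R : realType} {n : nat} {M : manifold R n}.

Lemma Cinf_cst1 : Cinf_cst M 1 = 1.
Proof. exact: val_inj. Qed.

Lemma Cinf_cstD (a b : R) : Cinf_cst M (a + b) = Cinf_cst M a + Cinf_cst M b.
Proof. exact: val_inj. Qed.

Lemma Cinf_cstM (a b : R) : Cinf_cst M (a * b) = Cinf_cst M a * Cinf_cst M b.
Proof. exact: val_inj. Qed.

(** The normalisation of [eplus] and [eminus]: their two equal contributions, each carrying the
    factor squared, add up to one. *)
Lemma Cinf_cst_half_sqr :
  Cinf_cst M (Num.sqrt 2)^-1 ^+ 2 *+ 2 = 1.
Proof.
rewrite expr2 mulr2n -Cinf_cstM -Cinf_cstD -Cinf_cst1; congr Cinf_cst.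
by rewrite -invfM -expr2 sqr_sqrtr ?ler0n// -mulr2n -[LHS]mulr_natl divff ?pnatr_eq0.
Qed.

(** The Leibniz rule on 1 = 1 * 1 gives X 1 = X 1 + X 1; linearity over the reals does the rest. *)
Lemma vfield_cst (X : vfield M) (a : R) : X (Cinf_cst M a) = 0.
Proof.
have X0 : X 0 = 0 by apply: (addrI (X 0)); rewrite -vfieldD_arg !addr0.
have X1 : X 1 = 0.
  by apply: (addrI (X 1)); rewrite addr0 -{3}(mulr1 1) (vfieldP X).2 mulr1 mul1r.
by rewrite -[Cinf_cst M a]mulr1 -[_ * 1]addr0 (vfieldP X).1 X0 X1 mulr0 addr0.
Qed.

Lemma vfieldZ_cst (X : vfield M) (a : R) (f : Cinf M) :
  X (Cinf_cst M a * f) = Cinf_cst M a * X f.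
Proof. by rewrite (vfieldP X).2 vfield_cst mul0r add0r. Qed.

Lemma vfield_ext (X Y : vfield M) : (forall f, X f = Y f) -> X = Y.
Proof. by move=> XY; apply: val_inj; apply/funext. Qed.

Lemma vfieldZE (f : Cinf M) (X : vfield M) (g : Cinf M) :
  (f *: X) g = f * X g.
Proof. by []. Qed.

Lemma lieE (X Y : vfield M) (f : Cinf M) : lie X Y f = X (Y f) - Y (X f).
Proof. by []. Qed.

Lemma oneform_ext (b c : oneform M) : (forall X, b X = c X) -> b = c.
Proof. by move=> bc; apply: val_inj; apply/funext. Qed.

Lemma lieZl_cst (a : R) (X Y : vfield M) :
  lie (Cinf_cst M a *: X) Y = Cinf_cst M a *: lie X Y.
Proof.
apply: vfield_ext => f; by rewrite !(vfieldZE, lieE) vfieldZ_cst mulrBr.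
Qed.

Lemma lieZr_cst (a : R) (X Y : vfield M) :
  lie X (Cinf_cst M a *: Y) = Cinf_cst M a *: lie X Y.
Proof.
apply: vfield_ext => f; by rewrite !(vfieldZE, lieE) vfieldZ_cst mulrBr.
Qed.

End ConstantFunctions.

Section Curvature.
Context {R : realType} {n : nat} {M : manifold R n}.
Variable nabla : affine_connection M.

Lemma nabla0l (Z : vfield M) : nabla 0 Z = 0.
Proof.
apply: (addrI (nabla 0 Z)).
by rewrite addr0 -{1}[nabla 0 Z]scale1r -nabla_linl scale1r addr0.
Qed.

Lemma nablaZl (f : Cinf M) (X Z : vfield M) :
  nabla (f *: X) Z = f *: nabla X Z.
Proof. by rewrite -[f *: X]addr0 nabla_linl nabla0l addr0. Qed.

Lemma nablaZr_cst (a : R) (X Z : vfield M) :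
  nabla X (Cinf_cst M a *: Z) = Cinf_cst M a *: nabla X Z.
Proof. by rewrite nabla_leibniz vfield_cst scale0r addr0. Qed.

Lemma curvatureZ1_cst (a : R) (X Y Z : vfield M) :
  curvature nabla (Cinf_cst M a *: X) Y Z =
  Cinf_cst M a *: curvature nabla X Y Z.
Proof. by rewrite /curvature lieZl_cst !nablaZl nablaZr_cst !scalerBr. Qed.

Lemma curvatureZ2_cst (a : R) (X Y Z : vfield M) :
  curvature nabla X (Cinf_cst M a *: Y) Z =
  Cinf_cst M a *: curvature nabla X Y Z.
Proof. by rewrite /curvature lieZr_cst !nablaZl nablaZr_cst !scalerBr. Qed.

Lemma curvatureZ3_cst (a : R) (X Y Z : vfield M) :
  curvature nabla X Y (Cinf_cst M a *: Z) =
  Cinf_cst M a *: curvature nabla X Y Z.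
Proof. by rewrite /curvature !nablaZr_cst !scalerBr. Qed.

End Curvature.

Section Tensor.
Context {R : realType} {n : nat} {M : manifold R n}.
Variable h : tensor02 M.

Lemma tensor0l (Z : vfield M) : h 0 Z = 0.
Proof.
apply: (addrI (h 0 Z)).
by rewrite addr0 -{1}[h 0 Z]mul1r -tensor_linl scale1r addr0.
Qed.

Lemma tensor0r (Z : vfield M) : h Z 0 = 0.
Proof.
apply: (addrI (h Z 0)).
by rewrite addr0 -{1}[h Z 0]mul1r -tensor_linr scale1r addr0.
Qed.

Lemma tensorZl f (X Z : vfield M) : h (f *: X) Z = f * h X Z.
Proof. by rewrite -[f *: X]addr0 tensor_linl tensor0l addr0. Qed.

Lemma tensorZr f (X Z : vfield M) : h Z (f *: X) = f * h Z X.
Proof. by rewrite -[f *: X]addr0 tensor_linr tensor0r addr0. Qed.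

Lemma flatZ f (X : vfield M) : flat h (f *: X) = f *: flat h X.
Proof. by apply: oneform_ext => Y; exact: tensorZl. Qed.

Hypothesis h_nondeg : tensor_nondegenerate h.

(** Non-degeneracy is pointwise: at each p the derivation X - Y kills every smooth function, so it
    vanishes. *)
Lemma flat_inj : injective (flat h).
Proof.
move=> X Y XY; apply: subr0_eq; apply: vfield_ext => f.
apply: val_inj; apply/funext => p; apply: h_nondeg => Z.
have hXY : h X Z = h Y Z := congr1 (fun b : oneform M => b Z) XY.
by rewrite -[X]scale1r -scaleN1r addrC tensor_linl scale1r hXY mulN1r addNr.
Qed.

Lemma flatK (X : vfield M) : sharp h (flat h X) = X.
Proof.
apply: flat_inj; rewrite /sharp.
(* The default 0 is excluded, since X itself is a preimage. *)
by case: xgetP => [Y _ //|/(_ X)]; case.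
Qed.

Variable nabla : affine_connection M.
Hypothesis h_parallel : tensor_parallel h nabla.

Lemma nabla_form_flat (X Y : vfield M) :
  nabla_form nabla X (flat h Y) = flat h (nabla X Y).
Proof.
apply: oneform_ext => Z; apply: subr0_eq.
by have := h_parallel X Y Z; rewrite addrAC.
Qed.

(** Both connections have the vector part of [nabla], and the weights (1 + a) / 2 and (1 - a) / 2
    sum to 1. *)
Lemma alpha_connection1 (a : R) (s t : gsection M) :
  (alpha_connection h nabla a s t).1 = nabla s.1 t.1.
Proof.
rewrite /= nabla_form_flat flatK -scalerDl -Cinf_cstD -mulrDl addrACA subrr.
by rewrite addr0 divff ?pnatr_eq0// Cinf_cst1 scale1r.
Qed.

Lemma gcurvature_alpha1 (a : R) (s t u : gsection M) :
  (gcurvature nabla (alpha_connection h nabla a) s t u).1 =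
  curvature nabla s.1 t.1 u.1.
Proof.
rewrite /gcurvature; move: (alpha_connection1 a).
(* With D abstract, simplification cannot unfold it and [D1] still matches. *)
by move: (alpha_connection h nabla a) => D D1; rewrite /= !D1.
Qed.

(** The 1-form part of s also enters [gbracket s t], but only in its 1-form part, which the
    connection ignores as a direction. *)
Lemma gcurvature_alpha_anchor (a : R) (s s' t u : gsection M) : s.1 = s'.1 ->
  gcurvature nabla (alpha_connection h nabla a) s t u =
  gcurvature nabla (alpha_connection h nabla a) s' t u.
Proof.
by rewrite /gcurvature /alpha_connection /hat_nabla /hat_nabla_star /= => ->.
Qed.

Lemma check_form_frame_pair (E : 'I_n -> vfield M) i (s : gsection M) :
  check_form h s (eplus h E i) + check_form h s (eminus h E i) =
  Cinf_cst M (Num.sqrt 2)^-1 * h s.1 (E i) *+ 2.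
Proof.
rewrite /check_form /=; set c := Cinf_cst _ _.
(* Scalars and sign move inside [flat], so that [flatK] removes each [sharp]. *)
rewrite -scaleN1r -!flatZ !flatK scaleN1r scalerN -scaleNr !tensorZr.
by rewrite mulNr addrACA subrr addr0.
Qed.

(** One factor 1 / sqrt 2 comes from the curvature direction and one from the pairing. *)
Lemma gRic_alpha (a : R) (E : 'I_n -> vfield M) (s u : gsection M) :
  gRic h nabla E (alpha_connection h nabla a) s u = Ric h nabla E s.1 u.1.
Proof.
apply: eq_bigr => i _; congr (_ * _).
rewrite (gcurvature_alpha_anchor a (eminus h E i) (eplus h E i))//.
rewrite check_form_frame_pair gcurvature_alpha1 curvatureZ1_cst tensorZl.
by rewrite mulrA -expr2 -mulrnAl Cinf_cst_half_sqr mul1r.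
Qed.

Lemma RicZZ_cst (a : R) (E : 'I_n -> vfield M) (Y Z : vfield M) :
  Ric h nabla E (Cinf_cst M a *: Y) (Cinf_cst M a *: Z) =
  Cinf_cst M a ^+ 2 * Ric h nabla E Y Z.
Proof.
rewrite /Ric mulr_sumr; apply: eq_bigr => i _.
by rewrite curvatureZ2_cst curvatureZ3_cst scalerA tensorZl -expr2 mulrCA.
Qed.

Lemma gscal_alpha (a : R) (E : 'I_n -> vfield M) :
  gscal h nabla E (alpha_connection h nabla a) = scal h nabla E.
Proof.
apply: eq_bigr => i _; congr (_ * _).
(* Here the two factors come from the two arguments of [Ric], again once for each sign. *)
by rewrite !gRic_alpha /= RicZZ_cst -mulr2n -mulrnAl Cinf_cst_half_sqr mul1r.
Qed.

End Tensor.

Theorem corollary3p16 (R : realType) (n : nat) (M : manifold R n)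
    (nabla : affine_connection M) (h : tensor02 M)
    (h_sym : tensor_symmetric h) (h_nondeg : tensor_nondegenerate h)
    (h_parallel : tensor_parallel h nabla) (a : R) :
  [/\ forall (U : set M) (E : 'I_n -> vfield M), orthonormal_frame h U E ->
        forall (Y Z : vfield M) (b c : oneform M) (p : M), U p ->
        gRic h nabla E (alpha_connection h nabla a) (Y, b) (Z, c) p
          = Ric h nabla E Y Z p,
      forall (U : set M) (E : 'I_n -> vfield M), orthonormal_frame h U E ->
        forall p : M, U p ->
        gscal h nabla E (alpha_connection h nabla a) p = scal h nabla E p &
      gRic_symmetric h nabla (alpha_connection h nabla a)
        <-> Ric_symmetric h nabla].
Proof.
split=> [U E _ Y Z b c p _|U E _ p _|]; [by rewrite gRic_alpha|by rewrite gscal_alpha|].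
split=> sym U E oE.
  (* Vector fields are lifted to sections with zero 1-form part. *)
  move=> Y Z p Up; have := sym U E oE (Y, 0) (Z, 0) p Up.
  by rewrite !gRic_alpha.
by move=> s u p Up; rewrite !gRic_alpha//; exact: sym oE _ _ _ Up.
Qed.
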